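(* Consider the two-stage multiderivative Runge-Kutta (MDRK) flux reconstruction scheme with subcell blending described in the context. Its high order and low order parts use the same inter-element numerical fluxes, namely $F^{(1)}_{e+1/2}$ in stage $1$ and $F^{(2)}_{e+1/2}$ in stage $2$, at every element interface $x_{e+1/2}$. Then for each stage $s\in\{1,2\}$ the following hold. 1. For every element $e$, the element means of the high order and low order updates of stage $s$ are equal: $$\sum_{j=0}^N w_j\, u^{H,(s)}_{e,j}=\sum_{j=0}^N w_j\, u^{L,(s)}_{e,j}.$$ Consequently, the blended update of stage $s$ is admissibility preserving in means if and only if the low order update of stage $s$ is admissibility preserving in means. 2. Suppose that: (a) the finite volume method that uses the lower order fluxes $f^{(s)}_{e+1/2}$ as the interface fluxes is admissibility preserving, i.e. whenever $u^n_{e,j}\in\mathcal U_{\mathrm{ad}}$ for all $e,j$, the updates $\hat u^{(s)}_{e,j}$ belong to $\mathcal U_{\mathrm{ad}}$ for all $e$ and all $0\le j\le N$; and (b) the common (blended) numerical fluxes $F^{(s)}_{e+1/2}$ are chosen to preserve the admissibility of the low order updates at the solution points adjacent to the interfaces, i.e. whenever $u^n_{e,j}\in\mathcal U_{\mathrm{ad}}$ for all $e,j$, one has $u^{L,(s)}_{e,0}\in\mathcal U_{\mathrm{ad}}$ and $u^{L,(s)}_{e,N}\in\mathcal U_{\mathrm{ad}}$ for all $e$. Then the blended update of stage $s$ is admissibility preserving in means.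
   Context: **Conservation law and admissible set.** Consider the one-dimensional system $u_t+f(u)_x=0$ with $u\in\mathbb R^d$ and flux $f$ with values in $\mathbb R^d$ (assumed defined at all states at which it is evaluated below). The admissible set is a convex set of the form $\mathcal U_{\mathrm{ad}}=\{u\in\mathbb R^d: p_k(u)>0,\ 1\le k\le K\}$, where each $p_k$ is a concave function on the set where $p_i>0$ for all $i<k$. **Mesh and solution points.** The domain is divided into elements $\Omega_e=[x_{e-1/2},x_{e+1/2}]$ of length $\Delta x_e>0$, each mapped to $[0,1]$ by $\xi=(x-x_{e-1/2})/\Delta x_e$. Let $N\ge 1$ and let $0\le \xi_0<\dots<\xi_N\le 1$ be the $N+1$ Gauss-Legendre or Gauss-Legendre-Lobatto points on $[0,1]$, with associated quadrature weights $w_0,\dots,w_N$ on $[0,1]$ (exact for polynomials of degree $\le 2N+1$, respectively $\le 2N-1$). Let $\ell_0,\dots,\ell_N$ be the Lagrange polynomials of degree $N$ with $\ell_i(\xi_j)=\delta_{ij}$, and let $D$ be the matrix with entries $D_{ij}=\ell_j'(\xi_i)$. The unknowns are the nodal values $u^n_{e,j}\in\mathbb R^d$, $0\le j\le N$. The element mean of nodal values $(v_{e,j})_j$ is $\sum_{j=0}^N w_j v_{e,j}$. **Stages.** Let $\Delta t>0$, $\tau_1=\Delta t/2$, $\tau_2=\Delta t$. Stage $1$ produces values $u^*_{e,j}$ from $u^n$; stage $2$ produces $u^{n+1}_{e,j}$ from $u^n$ and $u^*$. **High order nodal time averaged fluxes.** For a vector $v=(v_j)_{j=0}^N$ of nodal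 values in element $e$, set $$v^{(1)}_j=-\frac{\Delta t}{\Delta x_e}\sum_{i=0}^N D_{ji}f(v_i),$$ $$f^{(1)}[v]_j=\tfrac1{12}\left[-f(v_j+2v^{(1)}_j)+8f(v_j+v^{(1)}_j)-8f(v_j-v^{(1)}_j)+f(v_j-2v^{(1)}_j)\right].$$ With $u^n_e=(u^n_{e,j})_j$ and $u^*_e=(u^*_{e,j})_j$, the nodal fluxes of the two stages are $$\Phi^{(1)}_{e,j}=f(u^n_{e,j})+\tfrac14 f^{(1)}[u^n_e]_j,\qquad \Phi^{(2)}_{e,j}=f(u^n_{e,j})+\tfrac16\left(f^{(1)}[u^n_e]_j+2f^{(1)}[u^*_e]_j\right).$$ **Inter-element fluxes.** For each stage $s$ and each interface $x_{e+1/2}$ there is a single numerical flux value $F^{(s)}_{e+1/2}\in\mathbb R^d$, the (blended) numerical flux, used in both elements sharing the interface and in both the high order and low order updates below. **High order update.** Let $g_L,g_R$ be polynomials of degree at most $N+1$ with $g_L(0)=g_R(1)=1$ and $g_L(1)=g_R(0)=0$. In element $e$ put $F^{\delta,(s)}_h(\xi)=\sum_{j=0}^N\Phi^{(s)}_{e,j}\ell_j(\xi)$ and $$F^{(s)}_h(\xi)=\left[F^{(s)}_{e-1/2}-F^{\delta,(s)}_h(0)\right]g_L(\xi)+F^{\delta,(s)}_h(\xi)+\left[F^{(s)}_{e+1/2}-F^{\delta,(s)}_h(1)\right]g_R(\xi).$$ The high order update of stage $s$ is $$u^{H,(s)}_{e,j}=u^n_{e,j}-\frac{\tau_s}{\Delta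 x_e}\frac{dF^{(s)}_h}{d\xi}(\xi_j),\qquad 0\le j\le N.$$ **Low order update.** Each element is divided into $N+1$ subcells, the $j$-th of length $w_j\Delta x_e$. For $0\le j\le N-1$, let $f^{e,(s)}_{j+1/2}\in\mathbb R^d$ be the numerical flux at the face between subcells $j$ and $j+1$ of element $e$, and let $f^{(s)}_{e+1/2}\in\mathbb R^d$ be the lower order flux at the element interface $x_{e+1/2}$; these are computed from the values $u^n$ by a finite volume method on the subcells (for example, a first order method with $f^{e,(s)}_{j+1/2}=\hat f(u^n_{e,j},u^n_{e,j+1})$ and $f^{(s)}_{e+1/2}=\hat f(u^n_{e,N},u^n_{e+1,0})$ for a two-point numerical flux $\hat f$, or a method of MUSCL-Hancock type with a four-point stencil). The low order update of stage $s$ is $$u^{L,(s)}_{e,0}=u^n_{e,0}-\frac{\tau_s}{w_0\Delta x_e}\left[f^{e,(s)}_{1/2}-F^{(s)}_{e-1/2}\right],$$ $$u^{L,(s)}_{e,j}=u^n_{e,j}-\frac{\tau_s}{w_j\Delta x_e}\left[f^{e,(s)}_{j+1/2}-f^{e,(s)}_{j-1/2}\right],\quad 1\le j\le N-1,$$ $$u^{L,(s)}_{e,N}=u^n_{e,N}-\frac{\tau_s}{w_N\Delta x_e}\left[F^{(s)}_{e+1/2}-f^{e,(s)}_{N-1/2}\right].$$ The updates $\hat u^{(s)}_{e,j}$, $0\le j\le N$, are defined by the same three formulas with $F^{(s)}_{e\pm1/2}$ replaced by the lower order interface fluxes $f^{(s)}_{e\pm1/2}$. **Blended update.** With blending coefficients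 $\alpha_e\in[0,1]$, the blended update of stage $s$ is $$u^{(s)}_{e,j}=(1-\alpha_e)u^{H,(s)}_{e,j}+\alpha_e u^{L,(s)}_{e,j},$$ and $u^*_{e,j}:=u^{(1)}_{e,j}$, $u^{n+1}_{e,j}:=u^{(2)}_{e,j}$. **Admissibility preservation in means.** An update of stage $s$ producing nodal values $v_{e,j}$ (with $v=u^{H,(s)}$, $u^{L,(s)}$ or $u^{(s)}$) is called admissibility preserving in means if: $u^n_{e,j}\in\mathcal U_{\mathrm{ad}}$ for all $e,j$ implies $\sum_{j=0}^N w_j v_{e,j}\in\mathcal U_{\mathrm{ad}}$ for all $e$. *)

(* Defs.v *)
From HB Require Import structures.
From mathcomp Require Import all_boot all_order all_algebra.
From mathcomp Require Import all_classical all_reals all_analysis.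

Set Implicit Arguments.
Unset Strict Implicit.
Unset Printing Implicit Defensive.

Import Order.TTheory GRing.Theory Num.Theory.
Import numFieldNormedType.Exports.

Local Open Scope classical_set_scope.
Local Open Scope ring_scope.

Definition concave_on (R : realType) (E : lmodType R) (A : set E)
    (p : E -> R) : Prop :=
  @convex_function R E A (fun u => - p u).

Definition admissible_set (R : realType) (d K : nat)
    (p : 'I_K -> 'rV[R]_d -> R) : set 'rV[R]_d :=
  [set u | forall k, 0 < p k u].

(* The set on which p_k is required to be concave: p_i > 0 for all i < k. *)
Definition positive_before (R : realType) (d K : nat)
    (p : 'I_K -> 'rV[R]_d -> R) (k : 'I_K) : set 'rV[R]_d :=
  [set u | forall i : 'I_K, (i < k)%N -> 0 < p i u].

(* Legendre polynomial of degree n shifted to [0, 1], by Rodrigues' formula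
   P_n = (1 / n!) (d/dx)^n (x^2 - x)^n; note that ^`N(n) includes the 1 / n!. *)
Definition legendre01 (R : realType) (n : nat) : {poly R} :=
  (('X^2 - 'X) ^+ n)^`N(n).

Definition ordered_nodes (R : realType) (n : nat) (xi : 'I_n -> R) : Prop :=
  (forall j, 0 <= xi j <= 1) /\ (forall i j : 'I_n, (i < j)%N -> xi i < xi j).

Definition exact_to_degree (R : realType) (n : nat) (xi w : 'I_n -> R)
    (m : nat) : Prop :=
  forall q : {poly R}, (size q <= m.+1)%N ->
    \sum_(j < n) w j * q.[xi j]
    = \int[@lebesgue_measure R]_(x in `[0, 1]) q.[x].

(* The N+1 points are the N+1 roots of P_(N+1). *)
Definition gauss_legendre (R : realType) (N : nat)
    (xi w : 'I_N.+1 -> R) : Prop :=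
  [/\ ordered_nodes xi,
      forall j, root (legendre01 R N.+1) (xi j) &
      exact_to_degree xi w (2 * N + 1)].

(* The N+1 points are the endpoints 0, 1 and the N-1 roots of P_N'. *)
Definition gauss_lobatto (R : realType) (N : nat)
    (xi w : 'I_N.+1 -> R) : Prop :=
  [/\ ordered_nodes xi,
      forall j, root ('X * ('X - 1) * (legendre01 R N)^`()) (xi j) &
      exact_to_degree xi w (2 * N - 1)].

Definition lagrange_poly (R : realType) (n : nat) (xi : 'I_n -> R)
    (i : 'I_n) : {poly R} :=
  \prod_(j < n | j != i) ((xi i - xi j)^-1 *: ('X - (xi j)%:P)).

Inductive stage : Set := stage1 | stage2.

(* The elements are indexed by an interval J of integers, so that bounded
   domains and the whole line are both covered.  Element e lies between the
   interfaces with integer indices e and e + 1: index k stands for x_(k-1/2). *)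
Definition elt (J : interval int) : Type := {e : int | e \in J}.

Definition lface (J : interval int) (e : elt J) : int := sval e.
Definition rface (J : interval int) (e : elt J) : int := sval e + 1.

Definition state (R : realType) (d N : nat) (J : interval int) : Type :=
  elt J -> 'I_N.+1 -> 'rV[R]_d.

(* The time step, the blending coefficients and all numerical fluxes may depend
   on the data u^n.  The intermediate values u^* are themselves a function of
   u^n, so second-stage fluxes that use u^* are included.
   [subflux s u e j] is the flux at the face j+1/2 between the subcells j and
   j+1 of e, [lowflux s u k] the lower order flux at interface k, and
   [numflux s u k] the common (blended) numerical flux there. *)
Record scheme (R : realType) (d N : nat) (J : interval int) := Scheme {
  node : 'I_N.+1 -> R;
  weight : 'I_N.+1 -> R;
  interface : int -> R;
  flux : 'rV[R]_d -> 'rV[R]_d;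
  corrL : {poly R};
  corrR : {poly R};
  dt : state R d N J -> R;
  alpha : state R d N J -> elt J -> R;
  numflux : stage -> state R d N J -> int -> 'rV[R]_d;
  lowflux : stage -> state R d N J -> int -> 'rV[R]_d;
  subflux : stage -> state R d N J -> elt J -> 'I_N -> 'rV[R]_d }.

Definition dx (R : realType) (d N : nat) (J : interval int)
    (S : scheme R d N J) (e : elt J) : R :=
  interface S (rface e) - interface S (lface e).

Definition tau (R : realType) (d N : nat) (J : interval int)
    (S : scheme R d N J) (s : stage) (u : state R d N J) : R :=
  match s with stage1 => dt S u / 2 | stage2 => dt S u end.

Definition mean (R : realType) (d N : nat) (J : interval int)
    (S : scheme R d N J) (v : 'I_N.+1 -> 'rV[R]_d) : 'rV[R]_d :=
  \sum_j weight S j *: v j.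

Definition diff_mx (R : realType) (d N : nat) (J : interval int)
    (S : scheme R d N J) : 'M[R]_N.+1 :=
  \matrix_(i, j) (lagrange_poly (node S) j)^`().[node S i].

(* v^(1)_j; the data u enters only through the time step. *)
Definition time_diff (R : realType) (d N : nat) (J : interval int)
    (S : scheme R d N J) (u : state R d N J) (e : elt J)
    (v : 'I_N.+1 -> 'rV[R]_d) (j : 'I_N.+1) : 'rV[R]_d :=
  - (dt S u / dx S e) *: \sum_i diff_mx S j i *: flux S (v i).

(* f^(1)[v]_j *)
Definition flux_diff (R : realType) (d N : nat) (J : interval int)
    (S : scheme R d N J) (u : state R d N J) (e : elt J)
    (v : 'I_N.+1 -> 'rV[R]_d) (j : 'I_N.+1) : 'rV[R]_d :=
  let v1 := time_diff S u e v j in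
  12%:R^-1 *: (- flux S (v j + 2%:R *: v1) + 8%:R *: flux S (v j + v1)
               - 8%:R *: flux S (v j - v1) + flux S (v j - 2%:R *: v1)).

(* One component of the flux polynomial F^delta_h, resp. F_h, with nodal fluxes
   Phi and interface fluxes FL, FR. *)
Definition discont_flux (R : realType) (d N : nat) (J : interval int)
    (S : scheme R d N J) (Phi : 'I_N.+1 -> 'rV[R]_d) (c : 'I_d) : {poly R} :=
  \sum_j Phi j 0 c *: lagrange_poly (node S) j.

Definition cont_flux (R : realType) (d N : nat) (J : interval int)
    (S : scheme R d N J) (Phi : 'I_N.+1 -> 'rV[R]_d) (FL FR : 'rV[R]_d)
    (c : 'I_d) : {poly R} :=
  let Fd := discont_flux S Phi c in
  (FL 0 c - Fd.[0]) *: corrL S + Fd + (FR 0 c - Fd.[1]) *: corrR S.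

Definition fr_update (R : realType) (d N : nat) (J : interval int)
    (S : scheme R d N J) (s : stage) (Phi u : state R d N J) :
    state R d N J :=
  fun e j =>
    u e j - (tau S s u / dx S e) *:
      \row_c (cont_flux S (Phi e) (numflux S s u (lface e))
                (numflux S s u (rface e)) c)^`().[node S j].

(* Subcell finite volume update with interface fluxes G.  The face to the right
   (left) of subcell j is the interface when j is the last (first) subcell, i.e.
   when [unlift ord_max j] ([unlift ord0 j]) is [None]; otherwise it is the
   inner face j+1/2, with index j : 'I_N (resp. j-1/2, with index j-1). *)
Definition fv_update (R : realType) (d N : nat) (J : interval int)
    (S : scheme R d N J) (s : stage) (G : int -> 'rV[R]_d)
    (u : state R d N J) : state R d N J :=
  fun e j =>
    let right := oapp (subflux S s u e) (G (rface e)) (unlift ord_max j) in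
    let left := oapp (subflux S s u e) (G (lface e)) (unlift ord0 j) in
    u e j - (tau S s u / (weight S j * dx S e)) *: (right - left).

Definition low_update (R : realType) (d N : nat) (J : interval int)
    (S : scheme R d N J) (s : stage) (u : state R d N J) : state R d N J :=
  fv_update S s (numflux S s u) u.

Definition hat_update (R : realType) (d N : nat) (J : interval int)
    (S : scheme R d N J) (s : stage) (u : state R d N J) : state R d N J :=
  fv_update S s (lowflux S s u) u.

Definition blend (R : realType) (d N : nat) (J : interval int)
    (S : scheme R d N J) (u vH vL : state R d N J) : state R d N J :=
  fun e j => (1 - alpha S u e) *: vH e j + alpha S u e *: vL e j.

Definition Phi1 (R : realType) (d N : nat) (J : interval int)
    (S : scheme R d N J) (u : state R d N J) : state R d N J :=
  fun e j => flux S (u e j) + 4%:R^-1 *: flux_diff S u e (u e) j.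

Definition ustar (R : realType) (d N : nat) (J : interval int)
    (S : scheme R d N J) (u : state R d N J) : state R d N J :=
  blend S u (fr_update S stage1 (Phi1 S u) u) (low_update S stage1 u).

Definition Phi2 (R : realType) (d N : nat) (J : interval int)
    (S : scheme R d N J) (u : state R d N J) : state R d N J :=
  fun e j =>
    flux S (u e j) + 6%:R^-1 *:
      (flux_diff S u e (u e) j + 2%:R *: flux_diff S u e (ustar S u e) j).

Definition high_update (R : realType) (d N : nat) (J : interval int)
    (S : scheme R d N J) (s : stage) (u : state R d N J) : state R d N J :=
  fr_update S s (match s with stage1 => Phi1 S u | stage2 => Phi2 S u end) u.

Definition blended_update (R : realType) (d N : nat) (J : interval int)
    (S : scheme R d N J) (s : stage) (u : state R d N J) : state R d N J :=
  blend S u (high_update S s u) (low_update S s u).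

Definition all_admissible (R : realType) (d N : nat) (J : interval int)
    (U : set 'rV[R]_d) (u : state R d N J) : Prop :=
  forall e j, U (u e j).

Definition preserving_in_means (R : realType) (d N : nat) (J : interval int)
    (S : scheme R d N J) (U : set 'rV[R]_d)
    (update : state R d N J -> state R d N J) : Prop :=
  forall u, all_admissible U u -> forall e, U (mean S (update u e)).

(* Main.v *)
(* Both quadratures integrate the derivative of a polynomial of degree at most
   N + 1 exactly, so the mean of the high order update telescopes to the
   difference of the interface fluxes; so does the mean of the subcell update,
   because the subcell lengths are the quadrature weights.  The two means, and
   hence that of their blend, agree.  For the second part, the low order update
   differs from the admissible one only at the two outer solution points, where
   admissibility is assumed; since the weights are positive with sum 1,
   convexity makes the mean admissible. *)
Require Import Defs.
From HB Require Import structures.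
From mathcomp Require Import all_boot all_order all_algebra.
From mathcomp Require Import all_classical all_reals all_analysis.
From mathcomp Require Import polyrcf.
From mathcomp Require Import zify ring.

Set Implicit Arguments.
Unset Strict Implicit.
Unset Printing Implicit Defensive.

Import Order.TTheory GRing.Theory Num.Theory.
Import numFieldNormedType.Exports.

Local Open Scope classical_set_scope.
Local Open Scope ring_scope.

(** * Integrals of polynomials over [0, 1] *)

Lemma integral_deriv_poly (R : realType) (q : {poly R}) :
  \int[@lebesgue_measure R]_(x in `[0, 1]) q^`().[x] = q.[1] - q.[0].
Proof.
rewrite /Rintegral (@continuous_FTC2 _ _ (horner q)) //=.
- exact/continuous_subspaceT/continuous_horner.
- split=> [x _| |]; first exact: derivable_horner.
  + by apply: cvg_at_right_filter; exact: continuous_horner.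
  + by apply: cvg_at_left_filter; exact: continuous_horner.
- by move=> x _; rewrite derivE.
Qed.

Lemma antideriv_poly (R : realType) (q : {poly R}) :
  exists Q : {poly R}, Q^`() = q.
Proof.
(* At [i = 0] the division by zero yields 0, which fixes the constant term. *)
exists (\poly_(i < (size q).+1) (q`_i.-1 / i%:R)).
apply/polyP => i; rewrite coef_deriv coef_poly ltnS /=.
case: ltnP => [_|/leq_sizeP -> //]; last by rewrite mul0rn.
by rewrite -[LHS]mulr_natr divfK// pnatr_eq0.
Qed.

(** The numbers 1/(i+1) for [i < size q] are distinct roots in [0, 1], too many for a nonzero
    [q]. *)
Lemma poly_eq0_itv01 (R : realType) (q : {poly R}) :
  (forall x, 0 <= x <= 1 -> q.[x] = 0) -> q = 0.
Proof.
move=> q0; apply/eqP; apply: contraT => qn0.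
pose rs := mkseq (fun i => i.+1%:R^-1 : R) (size q).
suff : (size rs < size q)%N by rewrite size_mkseq ltnn.
apply: max_poly_roots => //.
  apply/allP => x /mapP[i _ ->]; rewrite /root q0 ?eqxx//.
  by rewrite invr_ge0 ler0n invf_le1 ?ltr0n// ler1n.
by apply: mkseq_uniq => i j /invr_inj /eqP; rewrite eqr_nat eqSS => /eqP.
Qed.

(** An antiderivative [Q] is nondecreasing on [0, 1]; if Q(0) = Q(1), it is constant there, hence
    constant as a polynomial, and its derivative is zero. *)
Lemma integral_poly_gt0 (R : realType) (q : {poly R}) :
  (forall x, 0 <= x <= 1 -> 0 <= q.[x]) -> q != 0 ->
  0 < \int[@lebesgue_measure R]_(x in `[0, 1]) q.[x].
Proof.
have [Q <-] := antideriv_poly q => Q'_ge0 Q'n0.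
rewrite integral_deriv_poly subr_gt0 lt_neqAle.
have Qle : {in `[0, 1] &, {homo horner Q : x y / x <= y}}.
  apply: ler_hornerW => x; rewrite in_itv/= => /andP[x0 x1].
  by apply: Q'_ge0; rewrite !ltW.
have I0 : 0 \in `[0, 1 : R] by rewrite in_itv/= lexx ler01.
have I1 : 1 \in `[0, 1 : R] by rewrite in_itv/= lexx ler01.
rewrite (Qle _ _ I0 I1 ler01) andbT; apply: contraNneq Q'n0 => Q01.
suff -> : Q = Q.[0]%:P by rewrite derivC.
apply/eqP; rewrite -subr_eq0; apply/eqP/poly_eq0_itv01 => x x01.
rewrite !hornerE; apply/eqP; rewrite subr_eq0 eq_le.
have Ix : x \in `[0, 1 : R] by rewrite in_itv.
have /andP[x0 x1] := x01.
by rewrite [X in _ <= X]Q01 !Qle.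
Qed.

(** * Positivity of the quadrature weights *)

(** On the test polynomial [q] the rule keeps only its [j]-th term, and by exactness this term is a
    positive integral. *)
Lemma quad_weight_gt0 (R : realType) (n m : nat) (xi w : 'I_n -> R)
    (j : 'I_n) (q : {poly R}) :
  exact_to_degree xi w m -> (size q <= m.+1)%N ->
  (forall x, 0 <= x <= 1 -> 0 <= q.[x]) -> 0 < q.[xi j] ->
  (forall i, i != j -> q.[xi i] = 0) ->
  0 < w j.
Proof.
move=> /[apply] wq q_ge0 qj_gt0 qi0; rewrite -(pmulr_lgt0 _ qj_gt0).
suff -> : w j * q.[xi j] = \sum_i w i * q.[xi i].
  rewrite wq; apply: integral_poly_gt0 => //.
  by apply: contraTneq qj_gt0 => ->; rewrite horner0 ltxx.
by rewrite (bigD1 j)//= [X in _ + X]big1 ?addr0// => i /qi0 ->; rewrite mulr0.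
Qed.

Lemma size_prod_degree_leq (R : realType) (I : finType) (P : pred I)
    (F : I -> {poly R}) (deg : I -> nat) :
  (forall i, size (F i) <= (deg i).+1)%N ->
  (size (\prod_(i | P i) F i)%R <= (\sum_(i | P i) deg i).+1)%N.
Proof.
move=> sF; apply: (big_ind2 (fun (q : {poly R}) d => size q <= d.+1)%N) => //.
  by rewrite size_poly1.
move=> q d q' d' sq sq'; apply: leq_trans (size_polyMleq _ _) _; lia.
Qed.

Lemma ordered_nodes_inj (R : realType) (n : nat) (xi : 'I_n -> R) :
  ordered_nodes xi -> injective xi.
Proof.
move=> [_ lt_xi] i j eq_xi; apply/val_inj; case: (ltngtP i j) => // /lt_xi.
all: by rewrite eq_xi ltxx.
Qed.

(** The test polynomial is the squared nodal product without [j], of degree 2N, within the exactness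
    2N + 1. *)
Lemma gauss_legendre_weight_gt0 (R : realType) (N : nat) (xi w : 'I_N.+1 -> R) :
  gauss_legendre xi w -> forall j, 0 < w j.
Proof.
move=> [nodes _ ex] j.
pose q := \prod_(i < N.+1 | i != j) ('X - (xi i)%:P) ^+ 2.
apply: (quad_weight_gt0 (j := j) (q := q) ex).
- apply: leq_trans (size_prod_degree_leq (deg := fun=> 2) _ _) _.
    by move=> i; rewrite size_exp_XsubC.
  rewrite sum_nat_const cardC1 card_ord; lia.
- move=> x _; rewrite horner_prod prodr_ge0// => i _.
  by rewrite horner_exp sqr_ge0.
- rewrite horner_prod prodr_gt0// => i ij.
  rewrite horner_exp hornerXsubC exprn_even_gt0//= subr_eq0.
  by rewrite (inj_eq (ordered_nodes_inj nodes)) eq_sym.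
- move=> i ij; rewrite horner_prod (bigD1 i)//= horner_exp hornerXsubC.
  by rewrite subrr expr0n mul0r.
Qed.

(** The coefficient of degree n is the leading coefficient 1 of (X^2 - X)^n times the binomial
    coefficient of 2n over n, which is nonzero in characteristic 0. *)
Lemma size_legendre01 (R : realType) (n : nat) :
  size (legendre01 R n) = n.+1.
Proof.
have sX : size ('X^2 - 'X : {poly R}) = 3.
  by rewrite size_polyDl size_polyXn// size_polyN size_polyX.
have mX : ('X^2 - 'X : {poly R}) \is monic.
  by rewrite monicE lead_coefDl ?lead_coefXn//
             size_polyN size_polyX size_polyXn.
have mP := monic_exp n mX.
have sP : size (('X^2 - 'X : {poly R}) ^+ n) = (2 * n).+1.
  by rewrite [LHS]polySpred ?monic_neq0// size_exp sX.
apply/eqP; rewrite eqn_leq; apply/andP; split.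
  by apply: leq_trans (size_poly _ _) _; rewrite sP; lia.
rewrite ltnNge; apply/negP => /leq_sizeP/(_ n (leqnn n))/eqP.
rewrite coef_nderivn; have := monicP mP.
rewrite lead_coefE sP /= mulSn mul1n => ->.
by rewrite pnatr_eq0 eqn0Ngt bin_gt0 leq_addr.
Qed.

(** The N + 1 distinct nodes exhaust the roots of a nonzero polynomial of degree at most N + 1, so
    its roots 0 and 1 are nodes; the ordering puts them first and last. *)
Lemma gauss_lobatto_endpoints (R : realType) (N : nat) (xi w : 'I_N.+1 -> R) :
  (1 <= N)%N -> gauss_lobatto xi w -> xi ord0 = 0 /\ xi ord_max = 1.
Proof.
move=> N_gt0 [nodes xi_root _].
set B := 'X * _ * _ in xi_root.
have sL : (size (legendre01 R N)^`() <= N)%N.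
  by rewrite -ltnS -(size_legendre01 R N) lt_size_deriv//
             -size_poly_gt0 size_legendre01.
(* This needs [1 <= N]: for N = 0 the Legendre polynomial is constant. *)
have L'n0 : (legendre01 R N)^`() != 0.
  rewrite -size_poly_eq0 -lt0n.
  case: N N_gt0 {xi w nodes xi_root B sL} => // N _.
  rewrite ltnNge; apply/negP => /leq_sizeP/(_ N (leq0n N))/eqP.
  rewrite coef_deriv -mulr_natr mulf_eq0 pnatr_eq0 orbF.
  have : lead_coef (legendre01 R N.+1) != 0.
    by rewrite lead_coef_eq0 -size_poly_gt0 size_legendre01.
  by rewrite lead_coefE size_legendre01 => /negbTE ->.
have Bn0 : B != 0.
  by rewrite /B !mulf_neq0 ?polyX_eq0// -polyC1 polyXsubC_eq0.
have sB : (size B <= N.+2)%N.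
  rewrite (leq_trans (size_polyMleq _ _))//.
  by rewrite mulrBr mulr1 -expr2 size_polyDl ?size_polyN ?size_polyX
             ?size_polyXn//.
have B_node c : root B c -> exists i, xi i = c.
  move=> Bc; apply: contrapT => c_notin.
  (* A root [c] off the nodes would give [B] N + 2 distinct roots. *)
  suff : (size (c :: codom xi) < size B)%N.
    by rewrite /= size_codom card_ord ltnNge sB.
  apply: max_poly_roots => //=.
    by rewrite Bc; apply/allP => _ /codomP[i ->].
  rewrite map_inj_uniq ?enum_uniq ?andbT; last exact: ordered_nodes_inj nodes.
  by apply/codomP => -[i ci]; apply: c_notin; exists i.
have [xi01 lt_xi] := nodes.
split.
- have [|i xi0] := B_node 0; first by rewrite !rootM rootX eqxx.
  suff -> : ord0 = i by [].
  apply/eqP/contraT; rewrite eq_sym -lt0n => /(lt_xi ord0); rewrite xi0 ltNge.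
  by have /andP[->] := xi01 ord0.
- have [|i xi1] := B_node 1.
    by rewrite !rootM -[1 in X in _ || X || _]polyC1 root_XsubC eqxx orbT.
  suff -> : ord_max = i by [].
  apply/eqP/contraT => ne_i; suff /lt_xi : (i < @ord_max N)%N.
    by rewrite xi1 ltNge; have /andP[_ ->] := xi01 ord_max.
  rewrite ltn_neqAle -(inj_eq val_inj) in ne_i *.
  by rewrite eq_sym ne_i -ltnS ltn_ord.
Qed.

(* The square of a Lagrange polynomial has degree 2N, one too many for the
   Lobatto rule: at each endpoint node the squared factor is replaced by a
   linear one of constant sign, which lowers the degree to at most 2N - 1. *)
Lemma gauss_lobatto_weight_gt0 (R : realType) (N : nat) (xi w : 'I_N.+1 -> R) :
  (1 <= N)%N -> gauss_lobatto xi w -> forall j, 0 < w j.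
Proof.
move=> N_gt0 gl j; have [xi0 xi1] := gauss_lobatto_endpoints N_gt0 gl.
have [nodes _ ex] := gl; have xi_inj := ordered_nodes_inj nodes.
pose F i : {poly R} :=
  if i == ord0 then 'X else if i == ord_max then 1 - 'X
  else ('X - (xi i)%:P) ^+ 2.
pose deg (i : 'I_N.+1) := if (i == ord0) || (i == ord_max) then 1%N else 2%N.
have F_node i : (F i).[xi i] = 0.
  rewrite /F; case: eqVneq => [->|_]; first by rewrite hornerX.
  case: eqVneq => [->|_]; first by rewrite !hornerE xi1 subrr.
  by rewrite horner_exp hornerXsubC subrr expr0n.
have F_ge0 i x : 0 <= x <= 1 -> 0 <= (F i).[x].
  move=> /andP[x0 x1]; rewrite /F; case: ifP => _; first by rewrite hornerX.
  case: ifP => _; first by rewrite !hornerE subr_ge0.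
  by rewrite horner_exp sqr_ge0.
have F_neq0 i k : k != i -> (F i).[xi k] != 0.
  rewrite -(inj_eq xi_inj) /F; case: (eqVneq i ord0) => [->|_].
    by rewrite hornerX xi0.
  case: (eqVneq i ord_max) => [->|_].
    by rewrite !hornerE xi1 subr_eq0 eq_sym.
  by rewrite horner_exp hornerXsubC expf_eq0 subr_eq0.
have sF i : (size (F i) <= (deg i).+1)%N.
  rewrite /F /deg; case: ifP => _ /=; first by rewrite size_polyX.
  case: ifP => _; last by rewrite size_exp_XsubC.
  by rewrite -opprB size_polyN -polyC1 size_XsubC.
have sum_deg : (\sum_i deg i = 2 * N)%N.
  rewrite {xi w gl j xi0 xi1 nodes ex xi_inj F F_node F_ge0 F_neq0 sF}/deg {deg}.
  case: N N_gt0 => // N _.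
  rewrite big_ord_recl big_ord_recr /= (eq_bigr (fun=> 2%N)).
    rewrite sum_nat_const card_ord /= (_ : lift _ _ == ord_max); first lia.
    exact/eqP/val_inj.
  move=> i _; rewrite ifN// -!(inj_eq val_inj)/= /bump/=.
  by have := ltn_ord i; lia.
apply: (quad_weight_gt0 (j := j) (q := \prod_(i < N.+1 | i != j) F i) ex).
(* All degrees sum to 2N and the omitted factor accounts for at least 1 of it. *)
- apply: leq_trans (size_prod_degree_leq _ sF) _.
  have : (0 < deg j)%N by rewrite /deg; case: ifP.
  move: sum_deg; rewrite (bigD1 j)//=.
  by move: (deg j) (\sum_(i < N.+1 | _) _)%N => a b; lia.
- by move=> x x01; rewrite horner_prod prodr_ge0// => i _; exact: F_ge0.
- rewrite horner_prod prodr_gt0// => i ij.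
  rewrite lt_neqAle eq_sym F_neq0 1?eq_sym//=.
  by rewrite F_ge0//; case: nodes.
- by move=> i ij; rewrite horner_prod (bigD1 i)//= F_node mul0r.
Qed.

(** * Weighted means in convex sets *)

(** Induction on the number of points, splitting off the first one. Normalising by the total weight,
    rather than assuming it to be 1, lets the induction hypothesis apply to the tail as it is. *)
Lemma convex_set_mean (R : realType) (E : lmodType R)
    (A : set (convex_lmodType E)) (n : nat) (w : 'I_n.+1 -> R)
    (v : 'I_n.+1 -> E) :
  convex_set A -> (forall j, 0 < w j) -> (forall j, A (v j)) ->
  A ((\sum_j w j)^-1 *: \sum_j w j *: v j).
Proof.
move=> cA; elim: n => [|n IH] in w v *; move=> w0 Av.
  by rewrite !big_ord1 scalerK// gt_eqF.
rewrite !(big_ord_recl n.+1) /=.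
set s := \sum_i w (lift ord0 i); set T := \sum_i w (lift ord0 i) *: _.
have s_gt0 : 0 < s.
  by rewrite /s big_ord_recl ltr_pwDl// sumr_ge0// => i _; exact: ltW.
have AT : A (s^-1 *: T) by exact: IH.
have w0s : 0 < w ord0 + s by rewrite addr_gt0.
have t_ge0 : 0 <= w ord0 / (w ord0 + s) by rewrite divr_ge0 ?ltW.
have t_le1 : w ord0 / (w ord0 + s) <= 1.
  by rewrite ler_pdivrMr// mul1r lerDl ltW.
have := cA _ _ (Itv01 t_ge0 t_le1) (mem_set (Av ord0)) (mem_set AT).
rewrite inE; congr A.
have sum0 : w ord0 + s != 0 by rewrite gt_eqF.
have -> : (w ord0 + s)^-1 *: (w ord0 *: v ord0 + T) =
    (w ord0 / (w ord0 + s)) *: v ord0 +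
    (1 - w ord0 / (w ord0 + s)) *: (s^-1 *: T).
  rewrite scalerDr !scalerA; congr (_ *: _ + _ *: _); first exact: mulrC.
  by field; rewrite sum0 gt_eqF.
by [].
Qed.

(** * Element means of the updates *)

Lemma size_lagrange_poly (R : realType) (n : nat) (xi : 'I_n -> R) (j : 'I_n) :
  (size (lagrange_poly xi j) <= n)%N.
Proof.
apply: leq_trans (size_prod_degree_leq (deg := fun=> 1%N) _ _) _ => [i|].
  by rewrite (leq_trans (size_scale_leq _ _))// size_XsubC.
by rewrite sum1_card cardC1 card_ord prednK// (leq_ltn_trans _ (ltn_ord j)).
Qed.

Section Scheme.
Variables (R : realType) (d N : nat) (J : interval int) (S : scheme R d N J).
Implicit Types (s : stage) (u : state R d N J) (e : elt J).

Lemma size_cont_flux (Phi : 'I_N.+1 -> 'rV[R]_d) (FL FR : 'rV[R]_d) (c : 'I_d) :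
  (size (corrL S) <= N.+2)%N -> (size (corrR S) <= N.+2)%N ->
  (size (cont_flux S Phi FL FR c) <= N.+2)%N.
Proof.
move=> sL sR; rewrite /cont_flux.
apply: leq_trans (size_polyD _ _) _; rewrite geq_max.
rewrite (leq_trans (size_scale_leq _ _) sR) andbT.
apply: leq_trans (size_polyD _ _) _; rewrite geq_max.
rewrite (leq_trans (size_scale_leq _ _) sL) /=.
apply: leq_trans (size_sum _ _ _) _; apply/bigmax_leqP => j _.
apply: leq_trans (size_scale_leq _ _) _.
exact: leq_trans (size_lagrange_poly _ _) _.
Qed.

(** The left correction cancels the trace of the discontinuous flux and puts the interface flux in
    its place. *)
Lemma cont_flux0 (Phi : 'I_N.+1 -> 'rV[R]_d) (FL FR : 'rV[R]_d) (c : 'I_d) :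
  (corrL S).[0] = 1 -> (corrR S).[0] = 0 ->
  (cont_flux S Phi FL FR c).[0] = FL 0 c.
Proof. by move=> L0 R0; rewrite /cont_flux !hornerD !hornerZ L0 R0; ring. Qed.

Lemma cont_flux1 (Phi : 'I_N.+1 -> 'rV[R]_d) (FL FR : 'rV[R]_d) (c : 'I_d) :
  (corrL S).[1] = 0 -> (corrR S).[1] = 1 ->
  (cont_flux S Phi FL FR c).[1] = FR 0 c.
Proof. by move=> L1 R1; rewrite /cont_flux !hornerD !hornerZ L1 R1; ring. Qed.

(** Inner subcells have no face on an element interface. This identifies [low_update] with
    [hat_update] away from the end points. *)
Lemma fv_update_inner s (G G' : int -> 'rV[R]_d) u e (j : 'I_N.+1) :
  j != ord0 -> j != ord_max -> fv_update S s G u e j = fv_update S s G' u e j.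
Proof.
rewrite eq_sym => /unlift_some[? _ j0].
by rewrite eq_sym => /unlift_some[? _ jN]; rewrite /fv_update j0 jN.
Qed.

Hypothesis N_gt0 : (1 <= N)%N.
Hypothesis quad : gauss_legendre (node S) (weight S) \/
                  gauss_lobatto (node S) (weight S).

Lemma weight_gt0 (j : 'I_N.+1) : 0 < weight S j.
Proof.
by case: quad => [/gauss_legendre_weight_gt0|/(gauss_lobatto_weight_gt0 N_gt0)].
Qed.

(** The derivative has degree at most N, and N <= 2N - 1 since N is at least 1, so both rules
    integrate it exactly. *)
Lemma quad_deriv (q : {poly R}) : (size q <= N.+2)%N ->
  \sum_j weight S j * q^`().[node S j] = q.[1] - q.[0].
Proof.
move=> sq; rewrite -integral_deriv_poly.
have sq' : (size q^`() <= N.+1)%N.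
  have [->|/lt_size_deriv] := eqVneq q 0; first by rewrite deriv0 size_poly0.
  by move/leq_trans => /(_ _ sq); rewrite ltnS.
by case: quad => [] [_ _]; apply; move: sq' N_gt0; lia.
Qed.

Lemma sum_weight : \sum_j weight S j = 1.
Proof.
(* The constant 1 is integrated as the derivative of ['X]. *)
have := @quad_deriv 'X; rewrite size_polyX derivX !hornerX subr0 => <- //.
by apply: eq_bigr => j _; rewrite hornerC mulr1.
Qed.

Lemma convex_mean (A : set 'rV[R]_d) (v : 'I_N.+1 -> 'rV[R]_d) :
  @convex_set R 'rV[R]_d A -> (forall j, A (v j)) -> A (mean S v).
Proof.
move=> cA Av; have := convex_set_mean cA weight_gt0 Av.
by rewrite sum_weight invr1 scale1r.
Qed.

Lemma mean_blend u (vH vL : state R d N J) e :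
  mean S (blend S u vH vL e) =
  (1 - alpha S u e) *: mean S (vH e) + alpha S u e *: mean S (vL e).
Proof.
rewrite /mean !scaler_sumr -big_split; apply: eq_bigr => j _ /=.
by rewrite /blend scalerDr !scalerA ![_ * weight S j]mulrC.
Qed.

(** The weight in the mean cancels the one in the subcell length; each inner face then occurs once
    as a right and once as a left face. *)
Lemma mean_fv_update s (G : int -> 'rV[R]_d) u e :
  mean S (fv_update S s G u e) =
  mean S (u e) - (tau S s u / dx S e) *: (G (rface e) - G (lface e)).
Proof.
pose right j := oapp (subflux S s u e) (G (rface e)) (unlift ord_max j).
pose left j := oapp (subflux S s u e) (G (lface e)) (unlift ord0 j).
have -> : G (rface e) - G (lface e) = \sum_j (right j - left j).
  (* Splitting off the last summand produces [widen_ord], whereas [unlift ord_max] inverts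
     [lift ord_max]. *)
  have widenE j : widen_ord (leqnSn N) j = lift ord_max j.
    by apply/val_inj; rewrite /= /bump leqNgt ltn_ord.
  rewrite sumrB big_ord_recr big_ord_recl /= /right /left !unlift_none /=.
  under eq_bigr => j _ do rewrite widenE liftK.
  under [X in _ - (_ + X)]eq_bigr => j _ do rewrite liftK.
  by rewrite /= [X in _ - X]addrC opprD addrACA subrr add0r.
rewrite /mean scaler_sumr -sumrB; apply: eq_bigr => j _.
rewrite /fv_update scalerBr scalerA; congr (_ - _ *: _).
by rewrite invfM mulrCA [X in _ * X]mulrA divff ?mul1r// gt_eqF// weight_gt0.
Qed.

(** Componentwise, [quad_deriv] turns the mean of the flux derivative into the difference of its end
    values, which the corrections make equal to the interface fluxes whatever [Phi] is. *)
Lemma mean_fr_update s (Phi u : state R d N J) e :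
  [/\ (size (corrL S) <= N.+2)%N, (corrL S).[0] = 1 & (corrL S).[1] = 0] ->
  [/\ (size (corrR S) <= N.+2)%N, (corrR S).[0] = 0 & (corrR S).[1] = 1] ->
  mean S (fr_update S s Phi u e) =
  mean S (u e) - (tau S s u / dx S e) *:
    (numflux S s u (rface e) - numflux S s u (lface e)).
Proof.
move=> [sL L0 L1] [sR R0 R1]; set FL := numflux S s u (lface e).
set FR := numflux S s u (rface e).
have -> : FR - FL = \sum_j weight S j *:
    \row_c (cont_flux S (Phi e) FL FR c)^`().[node S j].
  apply/rowP => c; rewrite summxE !mxE.
  rewrite -(cont_flux0 (Phi e) FL FR c L0 R0).
  rewrite -(cont_flux1 (Phi e) FL FR c L1 R1) -quad_deriv ?size_cont_flux//.
  by apply: eq_bigr => j _; rewrite !mxE.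
rewrite /mean scaler_sumr -sumrB; apply: eq_bigr => j _.
by rewrite /fr_update scalerBr !scalerA mulrC.
Qed.

End Scheme.

Theorem theorem1 (R : realType) (d N K : nat) (hN : (1 <= N)%N)
    (p : 'I_K -> 'rV[R]_d -> R)
    (hconcave : forall k : 'I_K, concave_on (positive_before p k) (p k))
    (hconvex : @convex_set R 'rV[R]_d (admissible_set p))
    (J : interval int) (S : scheme R d N J)
    (hmesh : forall e : elt J, 0 < dx S e)
    (hquad : gauss_legendre (node S) (weight S) \/
             gauss_lobatto (node S) (weight S))
    (hgL : [/\ (size (corrL S) <= N.+2)%N,
               (corrL S).[0] = 1 & (corrL S).[1] = 0])
    (hgR : [/\ (size (corrR S) <= N.+2)%N,
               (corrR S).[0] = 0 & (corrR S).[1] = 1])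
    (hdt : forall u, 0 < dt S u)
    (halpha : forall u e, 0 <= alpha S u e <= 1) :
  forall s : stage,
    ((forall (u : state R d N J) (e : elt J),
        mean S (high_update S s u e) = mean S (low_update S s u e)) /\
     (preserving_in_means S (admissible_set p) (blended_update S s) <->
      preserving_in_means S (admissible_set p) (low_update S s)))
    /\
    ((forall u, all_admissible (admissible_set p) u ->
        all_admissible (admissible_set p) (hat_update S s u)) ->
     (forall u, all_admissible (admissible_set p) u ->
        forall e : elt J,
          admissible_set p (low_update S s u e ord0) /\
          admissible_set p (low_update S s u e ord_max)) ->
     preserving_in_means S (admissible_set p) (blended_update S s)).
Proof.
move=> s.
have high_low u e : mean S (high_update S s u e) = mean S (low_update S s u e).
  (* Since [Phi] is arbitrary in [mean_fr_update], both stages are covered without examining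
     [ustar]. *)
  by rewrite mean_fr_update// mean_fv_update.
have blend_low u e :
    mean S (blended_update S s u e) = mean S (low_update S s u e).
  by rewrite mean_blend high_low -scalerDl subrK scale1r.
split; first split=> //.
  by split=> pres u uU e; move: (pres u uU e); rewrite blend_low.
move=> hat_adm ends_adm u uU e; rewrite blend_low; apply: convex_mean => // j.
have [->|j0] := eqVneq j ord0; first by case: (ends_adm u uU e).
have [->|jN] := eqVneq j ord_max; first by case: (ends_adm u uU e).
rewrite /low_update (fv_update_inner _ _ _ (lowflux S s u))//.
exact: hat_adm.
Qed.
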